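(* For all positive integers $k,K$ and every $\varepsilon>0$ there is $M$ such that for any random variables $X_1,\dots,X_M$ (on a common probability space) taking values in $\{1,\dots,K\}$, there are distinct $i_1,\dots,i_k\in\{1,\dots,M\}$ such that for every permutation $\pi$ of $\{1,\dots,k\}$, $$\big|\Pr(X_{i_{\pi(1)}}<\cdots<X_{i_{\pi(k)}})-\Pr(X_{i_1}<\cdots<X_{i_k})\big|<\varepsilon.$$ Consequently, there is a constant $C_k$ depending only on $k$ such that if moreover $\Pr(X_i=X_j)<\varepsilon$ for all distinct $i,j$, then for every permutation $\pi$ of $\{1,\dots,k\}$, $\Pr(X_{i_{\pi(1)}}<\cdots<X_{i_{\pi(k)}})>1/k!-C_k\varepsilon$. *)

(* Defs.v *)
From HB Require Import structures.
From mathcomp Require Export all_boot all_order all_fingroup all_algebra.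
From mathcomp Require Export all_classical all_reals all_analysis.

Set Implicit Arguments.
Unset Strict Implicit.
Unset Printing Implicit Defensive.

Local Open Scope classical_set_scope.

(* The event {Y 0 < Y 1 < ... < Y (k - 1)}; [enum 'I_k] lists 0, ..., k - 1 in
   increasing order and [sorted ltn] compares consecutive entries. *)
Definition chain_event (T : Type) (k : nat) (Y : 'I_k -> T -> nat) : set T :=
  [set t | sorted ltn [seq Y a t | a <- enum 'I_k]].

(* Main.v *)
Require Import Defs.
From mathcomp Require Import ring lra.
Import Order.TTheory GRing.Theory Num.Theory.
Local Open Scope classical_set_scope.
Local Open Scope ring_scope.

Set Implicit Arguments.
Unset Strict Implicit.
Unset Printing Implicit Defensive.

(** Ramsey's theorem, applied to the rounded probabilities of all the orderings
    of a [k]-tuple, yields [k ^ r] of the variables such that for each [s] the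
    probability of the ordering [s] is nearly the same for all increasing
    [k]-tuples.  An energy decrement argument in L^2 then produces [k] successive
    blocks of these variables, with weights, whose empirical distributions (the
    random measures giving the weighted frequency of each value in the block)
    are pairwise close in L^2.  Drawing one index from each block, the mean
    probability of the ordering [s] is the expectation of a multilinear
    expression in the [k] empirical distributions; exchanging these nearly equal
    factors changes it little, so it hardly depends on [s].  By homogeneity the
    same holds for every single increasing tuple.  For the second part, the [k!]
    orderings cover the event that the [k] values are distinct. *)

(** * Ramsey's theorem for subsequences of a sequence *)

Section Ramsey.
Variables (T : eqType) (C : finType).
Local Open Scope nat_scope.

Definition homogeneous (k : nat) (chi : seq T -> C) (c : C) (t : seq T) :=
  forall u, subseq u t -> size u = k -> chi u = c.

(** End-homogeneity: the colour of a subsequence of length [k.+1] depends only on its first entry,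
    next to which it is stored. *)
Fixpoint prehomogeneous (k : nat) (chi : seq T -> C) (t : seq (T * C)) : Prop :=
  if t is xc :: t' then
    homogeneous k (fun u => chi (xc.1 :: u)) xc.2 (map fst t')
    /\ prehomogeneous k chi t'
  else True.

Lemma prehomogeneous_filter k chi c t : prehomogeneous k chi t ->
  homogeneous k.+1 chi c [seq xc.1 | xc <- t & xc.2 == c].
Proof.
elim: t => [|[x d] t IHt] /= => [_ [|y u] //|[hx /IHt ht]].
case: (eqVneq d c) => //= dc [|y u] //=.
case: (eqVneq y x) => [-> sub [sz]|yx sub sz]; last exact: ht.
rewrite hx //; apply: subseq_trans sub _.
by apply: map_subseq; exact: filter_subseq.
Qed.

Lemma pigeonhole_count (A : Type) (f : A -> C) (N : nat) (s : seq A) :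
  #|C| * N < size s -> exists c, N <= count (fun a => f a == c) s.
Proof.
move=> sz; apply/existsP; case: (boolP [exists c, _]) => //.
rewrite negb_exists => /forallP small.
have : size s = \sum_(c : C) count (fun a => f a == c) s.
  elim: s {sz small} => [|a s IHs] /=; first by rewrite big1.
  rewrite big_split /= -IHs (bigD1 (f a)) //= eqxx big1 // => c ca.
  by rewrite eq_sym (negbTE ca).
move=> eq_sz; move: sz; rewrite eq_sz ltnNge -sum_nat_const leq_sum // => c _.
by apply: ltnW; rewrite ltnNge small.
Qed.

(** Induction on [k]: an end-homogeneous list is built entry by entry, the case [k] being applied to
    the tail coloured by [chi (x :: u)]. The pigeonhole principle on the stored colours then gives a
    homogeneous list. *)
Lemma ramsey (k N : nat) : exists M, forall (chi : seq T -> C) (s : seq T),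
  M <= size s ->
  exists t c, [/\ subseq t s, size t = N & homogeneous k chi c t].
Proof.
elim: k N => [|k IHk] N.
  exists N => chi s sz; exists (take N s), (chi [::]).
  by split; [exact: take_subseq|exact: size_takel|move=> u _ /size0nil->].
have pre L : exists M, forall (chi : seq T -> C) (s : seq T), M <= size s ->
    exists t, [/\ subseq (map fst t) s, size t = L & prehomogeneous k chi t].
  elim: L => [|L [M HM]].
    by exists 0 => chi s _; exists [::]; split => //; exact: sub0seq.
  have [M' HM'] := IHk M; exists M'.+1 => chi [//|x s] /= sz.
  have [t [c [ts tM tc]]] := HM' (fun u => chi (x :: u)) s sz.
  have [|t' [t't t'L t'p]] := HM chi t; first by rewrite tM.
  exists ((x, c) :: t'); split; rewrite /= ?t'L //.
    by rewrite eqxx; exact: subseq_trans t't ts.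
  by split => // u /subseq_trans/(_ t't); exact: tc.
have [M HM] := pre (#|C| * N).+1; exists M => chi s /(HM chi)[t [ts tL tp]].
have [|c cN] := @pigeonhole_count _ snd N t; first by rewrite tL.
set t' := [seq xc.1 | xc <- t & xc.2 == c].
have sub' : subseq (take N t') s.
  apply: subseq_trans (take_subseq _ _) (subseq_trans _ ts).
  by apply: map_subseq; exact: filter_subseq.
exists (take N t'), c; split => // [|u ut'].
  by rewrite size_takel // size_map size_filter.
exact: (prehomogeneous_filter tp) (subseq_trans ut' (take_subseq _ _)).
Qed.

End Ramsey.

(** * Energy decrement for block averages *)

Section BlockAverages.
Variable R : realFieldType.

(* The rows are probability vectors whose supports are successive: every index
   in the support of row [a] precedes every index in the support of row [b]
   whenever [a < b]. *)
Definition successive_averages (k N : nat) (w : 'M[R]_(k, N)) :=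
  [/\ forall a i, 0 <= w a i,
      forall a, \sum_i w a i = 1
    & forall (a b : 'I_k) i j, (a < b)%N -> w a i != 0 -> w b j != 0 ->
      (i < j)%N].

(** Needed to iterate averaging. An index in the support of a row of the product lies in the support
    of some [D g] with [w a g] nonzero, so the order is inherited through [g]. *)
Lemma successive_averagesM k n N (w : 'M[R]_(k, n)) (D : 'M[R]_(n, N)) :
  successive_averages w -> successive_averages D ->
  successive_averages (w *m D).
Proof.
move=> [w0 w1 wlt] [D0 D1 Dlt]; split.
- by move=> a i; rewrite mxE; apply: sumr_ge0 => j _; exact: mulr_ge0.
- move=> a; under eq_bigr do rewrite mxE.
  rewrite exchange_big /= -[RHS](w1 a); apply: eq_bigr => g _.
  by rewrite -mulr_sumr D1 mulr1.
- have supp a i : (w *m D) a i != 0 -> exists g, w a g != 0 /\ D g i != 0.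
    rewrite mxE => nz.
    have : [exists g, w a g * D g i != 0].
      apply: contraNT nz; rewrite negb_exists => /forallP H.
      by rewrite big1 // => g _; apply/eqP; rewrite -[_ == _]negbK H.
    by case/existsP => g; rewrite mulf_eq0 negb_or => /andP[]; exists g.
  move=> a b i j ab /supp[g [wg Dg]] /supp[h [wh Dh]].
  exact: Dlt (wlt _ _ _ _ ab wg wh) Dg Dh.
Qed.

Variable E : lmodType R.

Definition average k N (w : 'M[R]_(k, N)) (Y : 'I_N -> E) (a : 'I_k) : E :=
  \sum_i w a i *: Y i.

Lemma averageM k n N (w : 'M[R]_(k, n)) (D : 'M[R]_(n, N)) Y a :
  average (w *m D) Y a = average w (average D Y) a.
Proof.
rewrite /average; under eq_bigr do rewrite mxE scaler_suml.
rewrite exchange_big /=; apply: eq_bigr => g _.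
by rewrite scaler_sumr; apply: eq_bigr => i _; rewrite scalerA.
Qed.

Variable q : E -> R.
Hypothesis q_ge0 : forall x, 0 <= q x.
Hypothesis parallelogram : forall x y,
  q (2^-1 *: x + 2^-1 *: y) = (q x + q y) / 2 - q (x - y) / 4.

(* Cut the [k ^ r.+1] vectors into consecutive groups of [k].  Either some group
   is already pairwise close, or every group contains a pair whose midpoint has
   energy smaller by [eta]; the midpoints form a family of [k ^ r] vectors. *)
Lemma close_averages (k r : nat) (eta : R) (Y : 'I_(k ^ r) -> E) :
  (0 < k)%N -> (forall i, q (Y i) < r%:R * eta) ->
  exists w : 'M[R]_(k, k ^ r), successive_averages w /\
    forall a b, q (average w Y a - average w Y b) <= 4 * eta.
Proof.
move=> k_gt0; elim: r Y => [|r IHr] Y qY.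
  (* For [r = 0] the energy bound reads [q (Y i) < 0], which is absurd. *)
  have := qY (Ordinal (ltnSn 0)); rewrite mul0r => /(le_lt_trans (q_ge0 _)).
  by rewrite ltxx.
have idxP (g : 'I_(k ^ r)) (a : 'I_k) : (g * k + a < k ^ r.+1)%N.
  rewrite expnSr; apply: leq_trans (_ : g.+1 * k <= _)%N.
    by rewrite mulSn addnC ltn_add2r.
  by rewrite leq_mul2r ltn_ord orbT.
pose idx g a := Ordinal (idxP g a).
have sum_delta N (i0 : 'I_N) (F : 'I_N -> E) :
    \sum_i (i == i0)%:R *: F i = F i0.
  rewrite (bigD1 i0) //= eqxx scale1r big1 ?addr0 // => i /negbTE->.
  by rewrite scale0r.
have sum_delta1 N (i0 : 'I_N) : \sum_i (i == i0)%:R = 1 :> R.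
  by rewrite (bigD1 i0) //= eqxx big1 ?addr0 // => i /negbTE->.
have [/existsP[g /forallP close]|far] := boolP [exists g, forall a, forall b,
    q (Y (idx g a) - Y (idx g b)) <= 4 * eta].
  pose w : 'M[R]_(k, k ^ r.+1) := \matrix_(a, i) (i == idx g a)%:R.
  have avE a : average w Y a = Y (idx g a).
    by rewrite /average; under eq_bigr do rewrite mxE.
  exists w; split; last by move=> a b; rewrite !avE; exact: (forallP (close a)).
  split=> [a i|a|a b i j ab].
  - by rewrite mxE ler0n.
  - by under eq_bigr do rewrite mxE.
  - rewrite !mxE !pnatr_eq0 !eqb0 !negbK => /eqP-> /eqP->.
    by rewrite ltn_add2l.
have {far} farP g : exists ab : 'I_k * 'I_k,
    4 * eta < q (Y (idx g ab.1) - Y (idx g ab.2)).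
  move: far; rewrite negb_exists => /forallP/(_ g).
  rewrite negb_forall => /existsP[a]; rewrite negb_forall => /existsP[b].
  by rewrite -ltNge => ?; exists (a, b).
pose pr g := xchoose (farP g).
(* Row [g] averages the far pair of group [g], so [average D Y g] is its midpoint. *)
pose D : 'M[R]_(k ^ r, k ^ r.+1) := \matrix_(g, i)
  (2^-1 * (i == idx g (pr g).1)%:R + 2^-1 * (i == idx g (pr g).2)%:R).
have avD g : average D Y g
    = 2^-1 *: Y (idx g (pr g).1) + 2^-1 *: Y (idx g (pr g).2).
  rewrite /average; under eq_bigr do rewrite mxE scalerDl -!scalerA.
  by rewrite big_split /= -!scaler_sumr !sum_delta.
have sD : successive_averages D.
  split=> [g i|g|g h i j gh].
  - by rewrite mxE addr_ge0 ?mulr_ge0 ?invr_ge0 ?ler0n.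
  - under eq_bigr do rewrite mxE.
    by rewrite big_split /= -!mulr_sumr !sum_delta1 mulr1 [RHS]splitr mul1r.
  - have supp g' i' : D g' i' != 0 -> (i' %/ k = g')%N.
      have idx_div a : (idx g' a %/ k = g')%N.
        by rewrite divnMDl // divn_small ?addn0.
      rewrite mxE; case: (i' =P idx g' _) => [-> //|_].
      case: (i' =P idx g' _) => [-> //|_].
      by rewrite mulr0 addr0 eqxx.
    move=> /supp ig /supp jh; rewrite ltnNge; apply/negP => /(leq_div2r k).
    by rewrite ig jh leqNgt gh.
have [|w [sw cl]] := IHr (average D Y).
  (* The two energies are below [(r + 1) * eta] and the parallelogram law subtracts more than
     [eta]. *)
  move=> g; rewrite avD parallelogram.
  have := xchooseP (farP g); rewrite -/(pr g) => /=.
  have := qY (idx g (pr g).1); have := qY (idx g (pr g).2).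
  rewrite -natr1 mulrDl mul1r.
  move: (q _) (q _) (q _) => u v z uy vy zf.
  lra.
exists (w *m D); split; first exact: successive_averagesM.
by move=> a b; rewrite !averageM.
Qed.

End BlockAverages.

(** * Multilinear averages on a finite probability space *)

Section FiniteProcess.
Variable R : realFieldType.

(** Factors are exchanged one at a time; the bounds in [[0, 1]] are carried along the induction to
    absorb the cofactors. *)
Lemma ler_dist_prod (I : finType) (x y : I -> R) :
  (forall i, 0 <= x i <= 1) -> (forall i, 0 <= y i <= 1) ->
  `|\prod_i x i - \prod_i y i| <= \sum_i `|x i - y i|.
Proof.
move=> x01 y01.
suff [_ _] : [/\ 0 <= \prod_i x i <= 1, 0 <= \prod_i y i <= 1
  & `|\prod_i x i - \prod_i y i| <= \sum_i `|x i - y i|] by [].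
apply: (big_ind3 (fun X Y S : R =>
  [/\ 0 <= X <= 1, 0 <= Y <= 1 & `|X - Y| <= S])) => //.
  by rewrite subrr normr0 ler01 lexx.
move=> a b c a' b' c' [/andP[a0 a1] /andP[b0 b1] ab] [/andP[a'0 a'1] /andP[b'0 b'1] ab'].
split; try by apply/andP; split; [exact: mulr_ge0|exact: mulr_ile1].
have -> : a * a' - b * b' = a' * (a - b) + b * (a' - b') by ring.
apply: le_trans (ler_normD _ _) _; rewrite !normrM (ger0_norm a'0) (ger0_norm b0).
by apply: lerD; [apply: le_trans ab|apply: le_trans ab']; apply: ler_piMl.
Qed.

Variables (Omega V : finType) (p : Omega -> R).
Hypothesis p_ge0 : forall o, 0 <= p o.
Hypothesis p_sum1 : \sum_o p o = 1.
Variables (k N : nat) (Z : 'I_N -> Omega -> V).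

Definition expectation (F : {ffun 'I_k -> V} -> R) (j : 'I_k -> 'I_N) : R :=
  \sum_o p o * F [ffun a => Z (j a) o].

Definition frequency (w : 'M[R]_(k, N)) (a : 'I_k) (o : Omega) (u : V) : R :=
  \sum_i w a i * (Z i o == u)%:R.

(** If each [j a] is drawn independently from row [a], the values at a fixed [o] are independent
    with laws [frequency w a o]. *)
Lemma average_expectation (w : 'M[R]_(k, N)) F :
  \sum_(j : {ffun 'I_k -> 'I_N}) (\prod_a w a (j a)) * expectation F j
  = \sum_o p o * \sum_v F v * \prod_a frequency w a o (v a).
Proof.
under eq_bigr do rewrite /expectation mulr_sumr.
rewrite exchange_big /=; apply: eq_bigr => o _.
under [in RHS]eq_bigr => v _ do rewrite /frequency bigA_distr_bigA /= mulr_sumr.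
rewrite exchange_big /= mulr_sumr; apply: eq_bigr => j _.
rewrite mulrCA; congr (_ * _).
rewrite (bigD1 [ffun a => Z (j a) o]) //= [X in _ + X]big1 => [|v vZ].
  by rewrite addr0 mulrC; congr (_ * _); apply: eq_bigr => a _;
    rewrite ffunE eqxx mulr1.
have [a va] : exists a, Z (j a) o != v a.
  apply/existsP; apply: contraNT vZ; rewrite negb_exists => /forallP H.
  apply/eqP/ffunP => a; rewrite ffunE; apply/eqP.
  by rewrite eq_sym -[_ == _]negbK H.
by rewrite (bigD1 a) //= (negbTE va) mulr0 mul0r mulr0.
Qed.

Lemma frequency_itv w a o u : successive_averages w ->
  0 <= frequency w a o u <= 1.
Proof.
move=> [w0 w1 _]; apply/andP; split.
  by apply: sumr_ge0 => i _; rewrite mulr_ge0 ?ler0n.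
rewrite -(w1 a); apply: ler_sum => i _.
by rewrite ler_piMr // lern1 leq_b1.
Qed.

Definition permute_args (F : {ffun 'I_k -> V} -> R) (s : 'S_k)
    (v : {ffun 'I_k -> V}) : R := F [ffun a => v (s a)].

(** Permuting the arguments of [F] replaces factor [a] by factor [s^-1 a] in the multilinear
    formula. Each replacement costs at most [tau] in mean, for each of the [k] positions and each
    tuple [v]. *)
Lemma average_expectation_perm w (F : {ffun 'I_k -> V} -> R) (s : 'S_k) (tau : R) :
  successive_averages w -> 0 < tau -> (forall v, 0 <= F v <= 1) ->
  (forall a b, \sum_z p z.1 *
     (frequency w a z.1 z.2 - frequency w b z.1 z.2) ^+ 2 <= tau ^+ 2) ->
  `| \sum_(j : {ffun 'I_k -> 'I_N})
       (\prod_a w a (j a)) * expectation (permute_args F s) j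
   - \sum_(j : {ffun 'I_k -> 'I_N}) (\prod_a w a (j a)) * expectation F j|
  <= #|{ffun 'I_k -> V}|%:R * k%:R * tau.
Proof.
move=> sw tau0 F01 close; rewrite !average_expectation -sumrB.
pose f := frequency w.
have fE o : \sum_(v : {ffun 'I_k -> V}) F v * \prod_a f a o (v a)
    = \sum_(v : {ffun 'I_k -> V}) permute_args F s v * \prod_a f ((s^-1)%g a) o (v a).
  pose h (v : {ffun 'I_k -> V}) := [ffun a => v (s a)].
  have hbij : bijective h.
    exists (fun v : {ffun 'I_k -> V} => [ffun a => v ((s^-1)%g a)]) => v;
      by apply/ffunP => a; rewrite !ffunE ?permKV ?permK.
  rewrite (reindex h) /=; last exact: onW_bij.
  apply: eq_bigr => v _; congr (_ * _).
  rewrite [RHS](reindex_inj (@perm_inj _ s)) /=; apply: eq_bigr => a _.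
  by rewrite ffunE permK.
(* AM-GM replaces Cauchy-Schwarz: [|x| <= (tau + x^2 / tau) / 2]. *)
have L1 a b u : \sum_o p o * `|f a o u - f b o u| <= tau.
  have amgm (x : R) : `|x| <= (tau + x ^+ 2 / tau) / 2.
    rewrite ler_pdivlMr ?ltr0n // -(ler_pM2r tau0) mulrDl divfK ?gt_eqF //.
    rewrite -real_normK ?num_real //; have := sqr_ge0 (`|x| - tau).
    by rewrite !expr2; nra.
  apply: le_trans (_ : \sum_o p o * ((tau + (f a o u - f b o u) ^+ 2 / tau) / 2) <= _).
    by apply: ler_sum => o _; apply: ler_wpM2l.
  have -> : \sum_o p o * ((tau + (f a o u - f b o u) ^+ 2 / tau) / 2)
      = tau / 2 + (\sum_o p o * (f a o u - f b o u) ^+ 2) / tau / 2.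
    rewrite !mulr_suml -[X in X / 2]mul1r -p_sum1 !mulr_suml -big_split /=.
    by apply: eq_bigr => o _; ring.
  rewrite [leRHS]splitr lerD2l ler_pM2r ?invr_gt0 ?ltr0n // ler_pdivrMr //.
  rewrite -expr2; apply: le_trans (close a b).
  rewrite -(pair_bigA _ (fun o u' => p o * (f a o u' - f b o u') ^+ 2)) /=.
  apply: ler_sum => o _; rewrite (bigD1 u) //= lerDl.
  by apply: sumr_ge0 => u' _; rewrite mulr_ge0 ?sqr_ge0.
apply: le_trans (ler_norm_sum _ _ _) _.
apply: le_trans (_ : \sum_o p o * \sum_(v : {ffun 'I_k -> V}) \sum_a
    `|f a o (v a) - f ((s^-1)%g a) o (v a)| <= _).
  apply: ler_sum => o _; rewrite -mulrBr normrM ger0_norm //.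
  apply: ler_wpM2l => //; rewrite fE -sumrB.
  apply: le_trans (ler_norm_sum _ _ _) _; apply: ler_sum => v _.
  have /andP[P0 P1] : 0 <= permute_args F s v <= 1 by exact: F01.
  rewrite -mulrBr normrM (ger0_norm P0).
  apply: le_trans (ler_piMl (normr_ge0 _) P1) _.
  by apply: ler_dist_prod => a; exact: frequency_itv.
under eq_bigr do rewrite mulr_sumr.
rewrite exchange_big /= -mulrA mulr_natl -sumr_const.
apply: ler_sum => v _; under eq_bigr do rewrite mulr_sumr.
rewrite exchange_big /= mulr_natl -[X in _ *+ X]card_ord -sumr_const.
by apply: ler_sum => a _; exact: L1.
Qed.

Definition increasing (j : 'I_k -> 'I_N) :=
  forall a b : 'I_k, (a < b)%N -> (j a < j b)%N.

(** The weights sum to 1 and, the supports being successive, vanish unless [j] is increasing: the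
    average is a convex combination of nearby values. *)
Lemma expectation_near_average w (F : {ffun 'I_k -> V} -> R) (delta : R) j0 :
  successive_averages w ->
  (forall j, increasing j -> `|expectation F j - expectation F j0| <= delta) ->
  `|\sum_(j : {ffun 'I_k -> 'I_N}) (\prod_a w a (j a)) * expectation F j
    - expectation F j0| <= delta.
Proof.
move=> [w0 w1 wlt] near.
have W1 : \sum_(j : {ffun 'I_k -> 'I_N}) \prod_a w a (j a) = 1.
  by rewrite -bigA_distr_bigA big1.
rewrite -[X in _ - X]mul1r -[X in X * expectation F j0]W1 mulr_suml -sumrB.
rewrite -[delta]mul1r -[X in X * delta]W1 mulr_suml.
apply: le_trans (ler_norm_sum _ _ _) _; apply: ler_sum => j _.
rewrite -mulrBr normrM ger0_norm ?prodr_ge0 //.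
have [->|/prodf_neq0 nz] := eqVneq (\prod_a w a (j a)) 0; first by rewrite !mul0r.
apply: ler_wpM2l; first by rewrite prodr_ge0.
by apply: near => a b ab; apply: wlt ab _ _; exact: nz.
Qed.

End FiniteProcess.

(** * Near exchangeability of homogeneous families *)

Section Exchangeable.
Variables (R : realFieldType) (Omega V : finType) (p : Omega -> R).
Hypothesis p_ge0 : forall o, 0 <= p o.
Hypothesis p_sum1 : \sum_o p o = 1.

(** The energy decrement is run in L^2 of [Omega * V] weighted by [p], on the indicators of the
    graphs of the [Z i], whose averages are the frequencies. Passing between [j] and the average,
    once for [s] and once for the identity, costs [2 * delta]. *)
Lemma expectation_perm_close (k r : nat) (Z : 'I_(k ^ r) -> Omega -> V)
    (F : {ffun 'I_k -> V} -> R) (delta tau : R) :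
  (0 < k)%N -> 0 < tau -> 4 < r%:R * tau ^+ 2 -> (forall v, 0 <= F v <= 1) ->
  (forall s j j', increasing j -> increasing j' ->
     `|expectation p Z (permute_args F s) j
       - expectation p Z (permute_args F s) j'| <= delta) ->
  exists2 j : 'I_k -> 'I_(k ^ r), increasing j & forall s,
    `|expectation p Z (permute_args F s) j - expectation p Z F j|
      <= 2 * delta + #|{ffun 'I_k -> V}|%:R * k%:R * tau.
Proof.
move=> k_gt0 tau0 r_big F01 hom.
pose E : lmodType R := {ffun Omega * V -> R^o}.
pose q (x : E) : R := \sum_z p z.1 * x z ^+ 2.
pose Y i : E := [ffun z => (Z i z.1 == z.2)%:R].
have q_ge0 x : 0 <= q x by apply: sumr_ge0 => z _; rewrite mulr_ge0 ?sqr_ge0.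
have para x y : q (2^-1 *: x + 2^-1 *: y) = (q x + q y) / 2 - q (x - y) / 4.
  rewrite /q -big_split /= !mulr_suml -sumrB; apply: eq_bigr => z _.
  by rewrite !ffunE /GRing.scale /=; field.
(* Each indicator has energy 1; [eta = tau ^+ 2 / 4] makes the final closeness [4 * eta] equal to
   [tau ^+ 2]. *)
have qY i : q (Y i) < r%:R * (tau ^+ 2 / 4).
  have -> : q (Y i) = 1.
    rewrite /q -p_sum1; under eq_bigr do rewrite ffunE.
    rewrite -(pair_bigA _ (fun o u => p o * (Z i o == u)%:R ^+ 2)) /=.
    apply: eq_bigr => o _; rewrite (bigD1 (Z i o)) //= big1 => [|u uZ].
      by rewrite eqxx expr1n mulr1 addr0.
    by rewrite eq_sym (negbTE uZ) expr0n mulr0.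
  by rewrite mulrA ltr_pdivlMr ?mul1r ?ltr0n.
have [w [sw close]] := close_averages q_ge0 para k_gt0 qY.
have avE a z : average w Y a z = frequency Z w a z.1 z.2.
  by rewrite /average sum_ffunE; apply: eq_bigr => i _; rewrite !ffunE.
have [w0 w1 wlt] := sw.
have [j jP] : exists j : {ffun 'I_k -> 'I_(k ^ r)}, \prod_a w a (j a) != 0.
  apply/existsP; have : \sum_(j : {ffun 'I_k -> 'I_(k ^ r)}) \prod_a w a (j a) != 0.
    by rewrite -bigA_distr_bigA big1 ?oner_eq0.
  apply: contraNT; rewrite negb_exists => /forallP H.
  by rewrite big1 // => j _; apply/eqP; rewrite -[_ == _]negbK H.
have j_incr : increasing j.
  by move/prodf_neq0: jP => nz a b ab; apply: wlt ab _ _; exact: nz.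
have F1 : permute_args F 1 = F.
  apply/funext => v; congr F; apply/ffunP => a; by rewrite ffunE perm1.
exists j => // s.
have near s' := expectation_near_average sw
  (fun j' (Hj : increasing j') => hom s' j' j Hj j_incr).
have := near s; have := near 1%g; rewrite F1.
have : `|\sum_(j' : {ffun 'I_k -> 'I_(k ^ r)})
       (\prod_a w a (j' a)) * expectation p Z (permute_args F s) j'
   - \sum_(j' : {ffun 'I_k -> 'I_(k ^ r)})
       (\prod_a w a (j' a)) * expectation p Z F j'|
  <= #|{ffun 'I_k -> V}|%:R * k%:R * tau.
  apply: average_expectation_perm => // a b.
  have := close a b; rewrite mulrC divfK ?pnatr_eq0 //; apply: le_trans.
  by rewrite le_eqVlt; apply/orP; left; apply/eqP/eq_bigr => z _; rewrite !ffunE !avE.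
rewrite !ler_distl => /andP[? ?] /andP[? ?] /andP[? ?].
by apply/andP; split; lra.
Qed.

End Exchangeable.

(** * Choice of the indices by Ramsey's theorem *)

Lemma subseq_increasing (k N : nat) (t : seq nat) (j : 'I_k -> 'I_N) :
  size t = N -> increasing j ->
  subseq [seq nth 0%N t (j a) | a <- enum 'I_k] t.
Proof.
move=> sz j_incr.
suff sub : subseq [seq val (j a) | a <- enum 'I_k] (iota 0 N).
  have := map_subseq (nth 0%N t) sub.
  by rewrite -map_comp -[X in iota 0 X]sz -/(mkseq _ _) mkseq_nth.
have j_sorted : sorted ltn [seq val (j a) | a <- enum 'I_k].
  rewrite sorted_map; have := iota_ltn_sorted 0 k.
  rewrite -val_enum_ord sorted_map; apply: sub_sorted => a b; exact: j_incr.
(* A strictly increasing list is determined by its set of entries, so this one is [iota 0 N]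
   filtered by membership. *)
apply/subseq_uniqP; first exact: iota_uniq.
apply: (irr_sorted_eq ltn_trans ltnn) => //.
  by apply: sorted_filter; [exact: ltn_trans|exact: iota_ltn_sorted].
move=> x; rewrite mem_filter; apply/idP/andP => [xj|[]//]; split=> //.
by have /mapP[a _ ->] := xj; rewrite mem_iota /= add0n.
Qed.

Lemma trunc_eq_dist (R : archiRealFieldType) (x y : R) :
  0 <= x -> 0 <= y -> Num.truncn x = Num.truncn y -> `|x - y| <= 1.
Proof.
move=> /truncn_itv/andP[x0 x1] /truncn_itv/andP[y0 y1] xy.
move: x0 x1; rewrite xy ler_distl -natr1 => x0 x1; rewrite -natr1 in y1.
by apply/andP; split; lra.
Qed.

(** A [k]-tuple is coloured by its expectations for all [s], each rounded to a multiple of [1 / n].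
    All parameters are fixed before [Omega], so [M] is uniform in the process. *)
Lemma exists_nearly_exchangeable (R : archiRealFieldType) (V : finType)
    (k : nat) (F : {ffun 'I_k -> V} -> R) (eps : R) :
  (0 < k)%N -> 0 < eps -> (forall v, 0 <= F v <= 1) ->
  exists M, forall (Omega : finType) (p : Omega -> R) (X : 'I_M -> Omega -> V),
    (forall o, 0 <= p o) -> \sum_o p o = 1 ->
    exists2 i : 'I_k -> 'I_M, injective i & forall s,
      `|expectation p X (permute_args F s) i - expectation p X F i| < eps.
Proof.
move=> k_gt0 eps0 F01.
pose A : R := #|{ffun 'I_k -> V}|%:R * k%:R.
have A0 : 0 <= A by rewrite mulr_ge0 ?ler0n.
(* The final error is [2 * (eps / 4) + A * tau]; [A + 1] keeps the denominator positive. *)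
pose tau := eps / (4 * (A + 1)).
have tau0 : 0 < tau by rewrite divr_gt0 // mulr_gt0 ?ltr0n // ltr_wpDl.
have Atau : A * tau < eps / 2.
  rewrite /tau mulrA ltr_pdivrMr; last by rewrite mulr_gt0 ?ltr0n // ltr_wpDl.
  by nra.
pose r := (Num.truncn (4 / tau ^+ 2)).+1.
have r_big : 4 < r%:R * tau ^+ 2.
  by rewrite -ltr_pdivrMr ?exprn_gt0 // truncnS_gt.
pose n := (Num.truncn (4 / eps)).+1.
have n_big : 4 < n%:R * eps by rewrite -ltr_pdivrMr // truncnS_gt.
have n0 : 0 < n%:R :> R by rewrite ltr0n.
(* The rounding cells have width [1 / n < eps / 4]; an expectation equal to 1 gets the label [n],
   hence [n.+1] labels. *)
have [m Hm] := ramsey nat {ffun 'S_k -> 'I_n.+1} k (k ^ r).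
(* The successor provides the nonempty ordinal type that [inord] requires. *)
exists m.+1 => Omega p X p0 p1.
have E01 s i : 0 <= expectation p X (permute_args F s) i <= 1.
  apply/andP; split.
    by apply: sumr_ge0 => o _; rewrite mulr_ge0 //; exact: (proj1 (andP (F01 _))).
  rewrite -p1; apply: ler_sum => o _; rewrite ler_piMr //.
  exact: (proj2 (andP (F01 _))).
pose chi (u : seq nat) := [ffun s : 'S_k => inord (Num.truncn
  (n%:R * expectation p X (permute_args F s) (fun a => inord (nth 0%N u a))))
  : 'I_n.+1].
have [|t [c [ts szt hom]]] := Hm chi (iota 0 m.+1).
  by rewrite size_iota.
pose Z (i : 'I_(k ^ r)) := X (inord (nth 0%N t i)).
have [|j j_incr jP] := @expectation_perm_close R Omega V p p0 p1 k r Z F (eps / 4) tau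
    k_gt0 tau0 r_big F01.
  move=> s j j' jI j'I.
  have chiE l : increasing l -> expectation p Z (permute_args F s) l =
      expectation p X (permute_args F s)
        (fun a => inord (nth 0%N [seq nth 0%N t (l b) | b <- enum 'I_k] a)).
    move=> lI; apply: eq_bigr => o _; congr (_ * permute_args F s _).
    apply/ffunP => a; rewrite !ffunE (nth_map a) ?size_enum_ord //.
    by rewrite nth_ord_enum.
  have colour (l : 'I_k -> 'I_(k ^ r)) : increasing l -> chi [seq nth 0%N t (l b) | b <- enum 'I_k] = c.
    move=> lI; apply: hom; first exact: subseq_increasing szt lI.
    by rewrite size_map size_enum_ord.
  have := etrans (colour j jI) (esym (colour j' j'I)).
  move=> /ffunP/(_ s); rewrite !ffunE -!chiE // => /(congr1 val) /=.
  have tr (x : R) : 0 <= x <= 1 -> (Num.truncn (n%:R * x) < n.+1)%N.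
    move=> /andP[x0 x1]; rewrite ltnS -(ler_nat R).
    have /truncn_itv/andP[le_nx _] : 0 <= n%:R * x by rewrite mulr_ge0 ?ler0n.
    by apply: le_trans le_nx _; rewrite ler_piMr ?ler0n.
  rewrite !inordK ?tr //; [|by rewrite chiE ?E01|by rewrite chiE ?E01].
  move=> /trunc_eq_dist; rewrite -mulrBr normrM gtr0_norm //.
  have [e0 e'0] : 0 <= expectation p Z (permute_args F s) j /\
      0 <= expectation p Z (permute_args F s) j'.
    by rewrite !chiE //; split; apply: (proj1 (andP (E01 _ _))).
  rewrite !mulr_ge0 ?ler0n // => /(_ isT isT) le1.
  have : 0 <= `|expectation p Z (permute_args F s) j -
        expectation p Z (permute_args F s) j'| by [].
  by nra.
have t_uniq : uniq t by apply: subseq_uniq ts (iota_uniq _ _).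
exists (fun a => inord (nth 0%N t (j a))) => [a b|s].
  have tlt l : (nth 0%N t (j l) < m.+1)%N.
    have : nth 0%N t (j l) \in iota 0 m.+1.
      by apply: (mem_subseq ts); rewrite mem_nth ?szt.
    by rewrite mem_iota.
  move=> /(congr1 val); rewrite /= !inordK // => /eqP.
  rewrite nth_uniq ?szt // => /eqP jab.
  by case: (ltngtP a b) => [/j_incr|/j_incr|/val_inj//]; rewrite jab ltnn.
apply: le_lt_trans (jP s) _; rewrite -/A.
by lra.
Qed.

(** The positions are sorted by value; injectivity makes the weak order strict. *)
Lemma sorting_perm (k n : nat) (v : 'I_k -> 'I_n) : injective v ->
  exists s : 'S_k, sorted ltn [seq val (v (s a)) | a <- enum 'I_k].
Proof.
move=> v_inj; pose le := relpre (fun a => val (v a)) leq.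
have /tuple_permP[s sE] : perm_eq (sort le (ord_tuple k)) (ord_tuple k).
  by rewrite perm_sort.
exists s; rewrite ltn_sorted_uniq_leq map_inj_in_uniq ?enum_uniq; last first.
  by move=> a b _ _ /val_inj/v_inj/perm_inj.
have : sorted le (sort le (ord_tuple k)).
  by apply: sort_sorted => a b; exact: leq_total.
rewrite sE /=; rewrite /le -sorted_map -map_comp.
by congr (sorted _ _); apply: eq_map => a /=; rewrite tnth_ord_tuple.
Qed.

(** * The law of a finite-valued map *)

Section FiniteLaw.
Variables (R : realType) (d : measure_display) (T : measurableType d).
Variables (P : probability T R) (Omega : finType) (xi : T -> Omega).
Hypothesis xi_measurable : forall o, measurable (xi @^-1` [set o]).

Definition mass (o : Omega) : R := fine (P (xi @^-1` [set o])).

Lemma mass_ge0 o : 0 <= mass o.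
Proof. by rewrite fine_ge0 // measure_ge0. Qed.

Lemma probability_mem (s : seq Omega) : uniq s ->
  measurable [set t | xi t \in s] /\
  P [set t | xi t \in s] = (\sum_(o <- s) mass o)%:E.
Proof.
elim: s => [_|o s IHs /= /andP[os /IHs[ms Ps]]].
  rewrite big_nil (_ : [set t | _] = set0) ?measure0 //.
  by apply/seteqP; split.
have -> : [set t | xi t \in o :: s] = xi @^-1` [set o] `|` [set t | xi t \in s].
  apply/seteqP; split => t /=; rewrite inE.
    by case/orP => [/eqP->|]; [left|right].
  by case=> [->|->]; rewrite ?eqxx ?orbT.
split; first exact: measurableU.
rewrite measureU //; first rewrite big_cons EFinD -Ps /mass fineK //.
  by rewrite fin_num_measure.
by apply/seteqP; split => // t /= [-> H]; rewrite H in os.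
Qed.

(** This transfers events depending only on [xi] to finite sums, so that the finite results apply to
    any probability space. *)
Lemma probability_pred (phi : pred Omega) :
  P [set t | phi (xi t)] = (\sum_o mass o * (phi o)%:R)%:E.
Proof.
have [_] := probability_mem (enum_uniq phi); rewrite big_enum_cond /= => H.
transitivity (P [set t | xi t \in enum phi]).
  by congr (P _); apply/seteqP; split => t /=; rewrite mem_enum.
rewrite H big_mkcond /=; congr EFin; apply: eq_bigr => o _.
by rewrite unfold_in; case: (phi o); rewrite ?mulr1 ?mulr0.
Qed.

Lemma mass_sum1 : \sum_o mass o = 1.
Proof.
have := probability_pred predT; rewrite -[X in P X](_ : setT = _).
  rewrite probability_setT => -[->].
  by apply: eq_bigr => o _; rewrite mulr1.
by apply/seteqP; split.
Qed.

End FiniteLaw.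

(** * Chain events and ties in terms of the joint law *)

Section ChainEvents.
Variables (R : realType) (d : measure_display) (T : measurableType d).
Variables (P : probability T R) (M K : nat) (X : 'I_M -> {RV P >-> nat}).
Hypothesis X_le : forall j t, (X j t <= K)%N.

(** The whole family becomes one map to a finite space whose coordinates are the variables; values
    at most [K] fit in ['I_K.+1], so [inord] loses nothing. *)
Definition joint (t : T) : {ffun 'I_M -> 'I_K.+1} := [ffun j => inord (X j t)].

Lemma jointE j t : joint t j = X j t :> nat.
Proof. by rewrite ffunE inordK // ltnS. Qed.

Lemma joint_measurable o : measurable (joint @^-1` [set o]).
Proof.
have -> : joint @^-1` [set o] =
    \bigcap_(j in [set: 'I_M]) (X j @^-1` [set (o j : nat)]).
  apply/seteqP; split => [t /= <- j _ /=|t /= H].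
    by rewrite jointE.
  by apply/ffunP => j; apply/val_inj; rewrite /= jointE (H j I).
apply: fin_bigcap_measurable => // j _.
by apply: measurable_funPTI.
Qed.

Definition chain (k : nat) (v : {ffun 'I_k -> 'I_K.+1}) : bool :=
  sorted ltn [seq val (v a) | a <- enum 'I_k].

Lemma probability_chain_event (k : nat) (i : 'I_k -> 'I_M) (s : 'S_k) :
  P (chain_event (fun a => X (i (s a)))) =
  (expectation (mass P joint) (fun j o => o j)
    (permute_args (fun v => (chain v)%:R) s) i)%:E.
Proof.
rewrite -(probability_pred P joint_measurable
  (fun o => chain [ffun a => [ffun b => o (i b)] (s a)])).
congr (P _); apply/funext => t; rewrite /chain_event /chain /=.
congr (is_true (sorted _ _)); apply: eq_map => a.
by rewrite /= ffunE ffunE jointE.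
Qed.

Lemma probability_eq (j l : 'I_M) :
  P [set t | X j t = X l t] =
  (\sum_o mass P joint o * (o j == o l)%:R)%:E.
Proof.
rewrite -(probability_pred P joint_measurable (fun o => o j == o l)).
congr (P _); apply/seteqP; split => t /=; rewrite -!jointE.
  by move/val_inj->.
by move/eqP->.
Qed.

(* Distinct values are sorted by some permutation, so the chain events cover
   everything but the ties. *)
Lemma sum_chain_ge (k : nat) (i : 'I_k -> 'I_M) :
  1 <= \sum_(s : 'S_k) expectation (mass P joint) (fun j o => o j)
         (permute_args (fun v : {ffun 'I_k -> 'I_K.+1} => (chain v)%:R) s) i
     + \sum_(a < k) \sum_(b < k | a != b)
         \sum_o mass P joint o * (o (i a) == o (i b))%:R.
Proof.
(* Both sides become sums over [o], and it suffices that each mass has coefficient at least 1 on the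
   right. *)
rewrite -[leLHS](mass_sum1 P joint_measurable) exchange_big /=.
under [X in _ + X]eq_bigr do rewrite exchange_big /=.
rewrite [X in _ + X]exchange_big /= -big_split /=; apply: ler_sum => o _.
under [X in _ + X]eq_bigr do rewrite -mulr_sumr.
rewrite -!mulr_sumr -mulrDr ler_peMr ?mass_ge0 //.
have nn a : 0 <= \sum_(b < k | a != b) (o (i a) == o (i b))%:R :> R.
  by apply: sumr_ge0 => b _; rewrite ler0n.
have [/injectiveP inj|/injectivePn[a [b ab oab]]] :=
    boolP (injectiveb (fun a => o (i a))).
  have [s sP] := sorting_perm inj.
  rewrite (bigD1 s) //= {1}/permute_args {1}/chain.
  under eq_map do rewrite !ffunE.
  by rewrite sP mulr1n -addrA lerDl addr_ge0 ?sumr_ge0.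
rewrite [X in _ + X](bigD1 a) //= (bigD1 b) //= oab eqxx mulr1n.
rewrite addrCA -addrA lerDl !addr_ge0 ?sumr_ge0 // => *; exact: ler0n.
Qed.

End ChainEvents.

(** * Transfer to random variables and the lower bound *)

Theorem theorem8p1 (R : realType) (k : nat) (k_gt0 : (0 < k)%N) :
  exists C : R,
  forall (K : nat) (eps : R), (0 < K)%N -> 0 < eps ->
  exists M : nat,
  forall (d : measure_display) (T : measurableType d) (P : probability T R)
    (X : 'I_M -> {RV P >-> nat}),
  (forall j t, (1 <= X j t <= K)%N) ->
  exists i : 'I_k -> 'I_M,
    [/\ injective i,
        forall s : 'S_k,
          (`|P (chain_event (fun a => X (i (s a))))
             - P (chain_event (fun a => X (i a)))| < eps%:E)%E
      & (forall j l : 'I_M, j != l ->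
           (P [set t | X j t = X l t] < eps%:E)%E) ->
        forall s : 'S_k,
          ((1 / k`!%:R - C * eps)%:E
             < P (chain_event (fun a => X (i (s a)))))%E].
Proof.
(* Here [k * k] bounds the number of pairs that may tie, 2 comes from comparing two orderings
   through the identity, and one more [eps] makes the inequality strict. *)
exists (k%:R * k%:R + 3) => K eps _ eps0.
pose F (v : {ffun 'I_k -> 'I_K.+1}) : R := (chain v)%:R.
have F01 v : 0 <= F v <= 1 by rewrite ler0n lern1 leq_b1.
have [M HM] := exists_nearly_exchangeable k_gt0 eps0 F01.
exists M => d T P X X_itv.
have X_le j t : (X j t <= K)%N by have /andP[] := X_itv j t.
have mX := joint_measurable X_le.
pose coord j (o : {ffun 'I_M -> 'I_K.+1}) : 'I_K.+1 := o j.
have [i i_inj iP] := HM _ (mass P (joint K X)) coord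
  (mass_ge0 P _) (mass_sum1 P mX).
pose pr s := expectation (mass P (joint K X)) coord
  (permute_args F s) i.
have prE (s : 'S_k) : P (chain_event (fun a => X (i (s a)))) = (pr s)%:E.
  exact: probability_chain_event.
have pr1 : pr 1%g = expectation (mass P (joint K X)) coord F i.
  apply: eq_bigr => o _; congr (_ * F _).
  by apply/ffunP => a; rewrite ffunE perm1.
have prE1 : P (chain_event (fun a => X (i a))) = (pr 1%g)%:E.
  rewrite -prE; congr (P (chain_event _)).
  by apply/funext => a; rewrite perm1.
have close s : `|pr s - pr 1%g| < eps by rewrite pr1; exact: iP.
exists i; split=> // [s|ties s]; first by rewrite prE prE1 lte_fin.
rewrite prE lte_fin.
have tie a b : a != b ->
    \sum_o mass P (joint K X) o * (o (i a) == o (i b))%:R <= eps.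
  move=> ab; have := ties (i a) (i b); rewrite (inj_eq i_inj) => /(_ ab).
  by rewrite (probability_eq X_le) lte_fin => /ltW.
have := sum_chain_ge X_le i; rewrite -/pr.
have le1 : \sum_(s' : 'S_k) pr s' <= k`!%:R * (pr s + 2 * eps).
  rewrite mulr_natl -[in leRHS](card_Sn k) -cardsT -sumr_const.
  rewrite [leRHS](eq_bigl xpredT); last by move=> s'; rewrite !inE.
  apply: ler_sum => s' _; have := close s'; have := close s.
  by rewrite !ltr_distl => /andP[? ?] /andP[? ?]; lra.
have le2 : \sum_(a < k) \sum_(b < k | a != b)
    \sum_o mass P (joint K X) o * (o (i a) == o (i b))%:R <= k%:R * k%:R * eps.
  rewrite -mulrA mulr_natl -[X in _ *+ X]card_ord -sumr_const.
  apply: ler_sum => a _; rewrite mulr_natl -[X in _ *+ X]card_ord -sumr_const.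
  rewrite big_mkcond; apply: ler_sum => b _ /=.
  by case: ifP => [/tie//|_]; exact: ltW.
move=> /le_trans/(_ (lerD le1 le2)).
have f1 : 1 <= k`!%:R :> R by rewrite ler1n fact_gt0.
have f0 : 0 < k`!%:R :> R := lt_le_trans ltr01 f1.
move=> H; rewrite ltrBlDr ltr_pdivrMr //.
have k0 : 0 <= k%:R * k%:R :> R by rewrite mulr_ge0 ?ler0n.
have : k%:R * k%:R * eps <= k%:R * k%:R * eps * k`!%:R.
  by rewrite ler_peMr // mulr_ge0 // ltW.
have : 0 < k`!%:R * eps by rewrite mulr_gt0.
by rewrite !mulrDl; lra.
Qed.
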